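(* For every integer $n\ge 1$, the peak-nesting polynomial $\mathrm{Pnest}_n(t)=\sum_{\mathbf a\in\mathcal{DP}(n)}t^{\mathrm{pnest}(\mathbf a)}$ satisfies $$\mathrm{Pnest}_n(t)=\sum_{i=0}^{\lfloor\frac{n-1}{2}\rfloor}2^{n-1-2i}\sum_{\substack{M\in\mathcal{MP}(n)\\ \mathrm{u}(M)=i}}t^{\mathrm{height}(M)+1}=\sum_{i=0}^{\lfloor\frac{n-1}{2}\rfloor}2^{n-1-2i}\binom{n-1}{2i}\sum_{D\in\mathrm{Dyck}(i)}t^{\mathrm{height}(D)+1},$$ where $\mathcal{MP}(n)$ is the set of Motzkin paths of length $n-1$ and $\mathrm{Dyck}(i)$ is the set of Dyck paths of semilength $i$.
   Context: Write $[n]=\{1,\dots,n\}$. An area sequence of size $n$ is a sequence $\mathbf a=(a_1,\dots,a_n)$ of nonnegative integers with $a_i<i$ for all $i$ and $a_i\le a_{i-1}+1$ for all $i\ge 2$; $\mathcal{DP}(n)$ is the set of all of them. Each $\mathbf a\in\mathcal{DP}(n)$ defines a graph $\Gamma_{\mathbf a}$ (a unit interval graph) on $[n]$ with edges $\{j,i\}$ for $1\le j<i\le n$ with $i-a_i\le j$. If $\{i,j\}$ with $i<j$ is an edge then $\{i,i+1,\dots,j\}$ is a clique. A peak-edge of $\Gamma_{\mathbf a}$ is either an isolated vertex $i$ (put $j=i$) or an edge $\{i,j\}$, $i<j$, such that neither $\{i,j+1\}$ nor $\{i-1,j\}$ is an edge (pairs not contained in $[n]$ are not edges). The corresponding peak-clique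 is $\{i,i+1,\dots,j\}$. The peak-nesting of a vertex is the number of peak-cliques containing it, and $\mathrm{pnest}(\mathbf a)$ is the maximum of these numbers over all vertices. A Motzkin path of length $m\ge0$ is a lattice path from $(0,0)$ to $(m,0)$ with steps $U=(1,1)$, $D=(1,-1)$, $H=(1,0)$ that never goes below the $x$-axis; $\mathrm{u}(M)$ is its number of $U$ steps and $\mathrm{height}(M)$ is the largest $y$-coordinate it attains (0 for the empty path). A Dyck path of semilength $i$ is a Motzkin path of length $2i$ with no $H$ steps, and its height is defined in the same way. *)

(* Defs.v *)
From HB Require Import structures.
From mathcomp Require Import all_boot all_order all_algebra.

Set Implicit Arguments.
Unset Strict Implicit.
Unset Printing Implicit Defensive.

Import GRing.Theory.

(* The index set [n] = {1, .., n} is encoded as 'I_n, with x : 'I_n standing   *)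
(* for x + 1. Hence a_i < i reads a x <= x, while i - a_i <= j reads           *)
(* x - a x <= y (the subtraction is exact on area sequences). As a_i < i <= n, *)
(* the entries of an area sequence of size n all live in 'I_n.                 *)
Definition DP n : {set {ffun 'I_n -> 'I_n}} :=
  [set a : {ffun 'I_n -> 'I_n} |
    [forall x : 'I_n, a x <= x]
    && [forall x : 'I_n, forall y : 'I_n, (y == x.+1 :> nat) ==> (a y <= (a x).+1)]].

Section UnitIntervalGraph.

Variables (n : nat) (a : {ffun 'I_n -> 'I_n}).

Definition uig_edge : rel 'I_n := fun x y : 'I_n =>
  ((x < y) && (y - a y <= x)) || ((y < x) && (x - a x <= y)).

Definition isolated (x : 'I_n) : bool := [forall y : 'I_n, ~~ uig_edge x y].

(* Quantifying over the successor of p.2 and the predecessor of p.1 in 'I_n    *)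
(* makes the corresponding condition void when that vertex does not exist.     *)
Definition peak_edge (p : 'I_n * 'I_n) : bool :=
  ((p.1 == p.2) && isolated p.1)
  || [&& p.1 < p.2, uig_edge p.1 p.2,
         [forall y : 'I_n, (y == p.2.+1 :> nat) ==> ~~ uig_edge p.1 y]
       & [forall x : 'I_n, (x.+1 == p.1 :> nat) ==> ~~ uig_edge x p.2]].

Definition peak_clique (p : 'I_n * 'I_n) : {set 'I_n} :=
  [set v : 'I_n | p.1 <= v <= p.2].

Definition peak_cliques : {set {set 'I_n}} :=
  [set peak_clique p | p in [pred p | peak_edge p]].

Definition peak_nesting (v : 'I_n) : nat := #|[set C in peak_cliques | v \in C]|.

Definition pnest : nat := \max_(v : 'I_n) peak_nesting v.

End UnitIntervalGraph.

Definition Pnest n : {poly int} := (\sum_(a in DP n) 'X^(pnest a))%R.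

Inductive step := U | D | H.

Definition step_to_ord (s : step) : 'I_3 :=
  match s with U => @Ordinal 3 0 isT | D => @Ordinal 3 1 isT | H => @Ordinal 3 2 isT end.

Definition step_of_ord (i : 'I_3) : step :=
  match val i with 0 => U | 1 => D | _ => H end.

Lemma step_to_ordK : cancel step_to_ord step_of_ord.
Proof. by case. Qed.

HB.instance Definition _ := Finite.copy step (can_type step_to_ordK).

Definition rise (s : step) : int :=
  match s with U => 1%R | D => (-1)%R | H => 0%R end.

Section LatticePaths.

Variable m : nat.
Implicit Type w : m.-tuple step.

(* A lattice path from the origin is identified with its sequence of steps;    *)
(* its vertices are the points (k, ycoord w k) for 0 <= k <= m.                *)
Definition ycoord w (k : nat) : int := (\sum_(s <- take k w) rise s)%R.

Definition Motzkin : {set m.-tuple step} :=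
  [set w : m.-tuple step |
    [forall k : 'I_m.+1, (0 <= ycoord w k)%R] && (ycoord w m == 0%R)].

Definition nup w : nat := count_mem U w.

(* The absolute value only casts to nat: the ordinates of a Motzkin path are   *)
(* nonnegative.                                                                *)
Definition height w : nat := \max_(k < m.+1) `|ycoord w k|%N.

End LatticePaths.

Definition Dyck i : {set (2 * i).-tuple step} :=
  [set w in Motzkin (2 * i) | H \notin w].

(* Main.v *)
(* Let l_k = k - a_k be the leftmost vertex equal or adjacent to k. The map l  *)
(* is nondecreasing with l_k <= k, and the peak-cliques are the intervals      *)
(* [l_j, j] for the j with j = n or l_(j+1) <> l_j. Let L be the set of their  *)
(* left ends (the image of l) and R the set of their right ends. The number of *)
(* peak-cliques containing v is the number of left ends <= v minus the number  *)
(* of right ends < v, and it is always positive. So reading whether k is in R  *)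
(* and whether k + 1 is in L, for 1 <= k < n, gives a Motzkin path of length   *)
(* n - 1 with two colours of flat steps, whose height is pnest(a) - 1.         *)
(* Conversely l_j is the element of L whose rank, counted from 0, is the       *)
(* number of right ends < j, so this is a bijection. Forgetting the colours    *)
(* has fibres of size 2^(number of flat steps), and erasing the flat steps     *)
(* preserves the height and has fibres of size C(n - 1, 2 i).                  *)
Require Import Defs.
From mathcomp Require Import all_boot all_order all_algebra.
From mathcomp Require Import zify.
Import GRing.Theory.
Local Open Scope ring_scope.

Set Implicit Arguments.
Unset Strict Implicit.
Unset Printing Implicit Defensive.

(** * Erasing the flat steps of a Motzkin path *)

(** With [m] = n - 1 and vertices numbered from 0, an area sequence amounts to a nondecreasing map l
    with l k <= k, and its peak-cliques are the intervals [l j, j] at the right ends j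
    ([peak_edgeE]). The number of them through v is therefore a difference of two counting functions
    ([cnt_nesting]), and this is one more than the ordinate at v of the path that records the ends
    ([ycoord_shapes], [pnest_code]).

    The two sets of ends determine l by rank ([cnt_left_end_rank], [ends_inj]), and every pair of
    sets whose counts satisfy the Motzkin conditions arises ([realize]). So [code] is a bijection
    from area sequences onto Motzkin paths with two colours of flat steps.

    Counting the colourings of a path ([card_shapes_fibre]) gives the powers of 2. Erasing flat
    steps keeps the height ([height_flatless]), and counting the ways to insert them into a Dyck
    path ([card_flatless_fibre]) gives the binomial coefficients. *)

Lemma big_tuple_cons (T : finType) (V : nmodType) m (F : m.+1.-tuple T -> V) :
  \sum_(t : m.+1.-tuple T) F t = \sum_(x : T) \sum_(t : m.-tuple T) F (cons_tuple x t).
Proof.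
rewrite pair_big /= (reindex (fun p : T * m.-tuple T => cons_tuple p.1 p.2)) //=.
exists (fun t => (thead t, [tuple of behead t])) => [[x t] _|t _] /=.
  by congr pair; apply: val_inj.
by rewrite [RHS]tuple_eta.
Qed.

Lemma big_step (V : nmodType) (F : step -> V) : \sum_s F s = F U + (F D + F H).
Proof.
rewrite (reindex step_of_ord) /=; last first.
  by exists step_to_ord => [[[|[|[|]]] //= ?] _|s _]; [exact: val_inj..| exact: step_to_ordK].
by rewrite 3!big_ord_recl big_ord0 addr0.
Qed.

Lemma sum_rise (s : seq step) :
  \sum_(x <- s) rise x = (count_mem U s)%:Z - (count_mem D s)%:Z.
Proof.
elim: s => [|x s IH]; first by rewrite big_nil.
by rewrite big_cons IH; case: x => /=; lia.
Qed.

Lemma size_steps (s : seq step) :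
  size s = (count_mem U s + count_mem D s + count_mem H s)%N.
Proof. by elim: s => //= x s ->; case: x => /=; lia. Qed.

Lemma MotzkinP m (w : m.-tuple step) :
  reflect ((forall k, 0 <= ycoord w k) /\ ycoord w m = 0) (w \in Motzkin m).
Proof.
rewrite inE; apply: (iffP andP) => [[/forallP Hw /eqP Hm]|[Hw Hm]]; last first.
  by split; [apply/forallP => k | apply/eqP].
split=> // k; case: (ltnP k m.+1) => [lt_k|/ltnW le_k]; first exact: (Hw (Ordinal lt_k)).
by have := Hw ord_max; rewrite /ycoord !take_oversize ?size_tuple.
Qed.

Lemma leq_ycoord_height m (w : m.-tuple step) k : (`|ycoord w k| <= height w)%N.
Proof.
rewrite /height; case: (ltnP k m.+1) => [lt_k|/ltnW le_k].
  exact: (leq_bigmax (Ordinal lt_k)).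
suff -> : ycoord w k = ycoord w (@ord_max m) by apply: leq_bigmax.
by rewrite /ycoord !take_oversize ?size_tuple.
Qed.

Lemma Motzkin_count m (w : m.-tuple step) : w \in Motzkin m ->
  (2 * nup w + count_mem H w = m)%N.
Proof.
case/MotzkinP=> _; rewrite /ycoord take_oversize ?size_tuple // sum_rise.
by have := size_steps w; rewrite size_tuple /nup; lia.
Qed.

Definition flatless (s : seq step) := [seq x <- s | x != H].

Lemma sum_rise_flatless s : \sum_(x <- flatless s) rise x = \sum_(x <- s) rise x.
Proof.
by rewrite big_filter big_mkcond; apply: eq_bigr => -[].
Qed.

(** With [filter_take], this matches prefixes of a path with prefixes of its erased version; since
    flat steps do not move the ordinate, both paths visit the same set of ordinates, whence the same
    height and the same Motzkin condition. *)
Lemma take_filter T (p : pred T) s k :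
  exists j, take j [seq x <- s | p x] = [seq x <- take k s | p x].
Proof.
elim: s k => [|x s IH] [|k] /=; try by exists 0%N; rewrite ?take0.
have [j Hj] := IH k; case: ifP => _; [by exists j.+1; rewrite /= Hj | by exists j].
Qed.

Lemma filter_take T (p : pred T) s j :
  exists k, take j [seq x <- s | p x] = [seq x <- take k s | p x].
Proof.
elim: s j => [|x s IH] j; first by exists 0%N.
case: j => [|j]; first by exists 0%N; rewrite take0.
case px: (p x).
  by have [k Hk] := IH j; exists k.+1; rewrite /= px /= Hk.
by have [k Hk] := IH j.+1; exists k.+1; rewrite /= px Hk.
Qed.

Section Flatless.

Variables (m l : nat) (w : m.-tuple step) (d : l.-tuple step).
Hypothesis def_d : flatless w = d.

Lemma ycoord_flatlessr k : exists j, ycoord w k = ycoord d j.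
Proof.
have [j Hj] := take_filter (fun x => x != H) w k; exists j.
by rewrite /ycoord -def_d Hj sum_rise_flatless.
Qed.

Lemma ycoord_flatlessl j : exists k, ycoord d j = ycoord w k.
Proof.
have [k Hk] := filter_take (fun x => x != H) w j; exists k.
by rewrite /ycoord -def_d Hk sum_rise_flatless.
Qed.

Lemma Motzkin_flatless : (w \in Motzkin m) = (d \in Motzkin l).
Proof.
have Eml : ycoord w m = ycoord d l.
  by rewrite /ycoord !take_oversize ?size_tuple // -def_d sum_rise_flatless.
apply/MotzkinP/MotzkinP; rewrite Eml => -[H1 ->]; split=> // k.
  by have [j ->] := ycoord_flatlessl k.
by have [j ->] := ycoord_flatlessr k.
Qed.

Lemma height_flatless : height w = height d.
Proof.
apply/eqP; rewrite eqn_leq; apply/andP; split; apply/bigmax_leqP => k _.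
  by have [j ->] := ycoord_flatlessr k; apply: leq_ycoord_height.
by have [j ->] := ycoord_flatlessl k; apply: leq_ycoord_height.
Qed.

Lemma nup_flatless : nup w = nup d.
Proof.
rewrite /nup -def_d count_filter; apply: eq_count => x.
by case: x.
Qed.

End Flatless.

(** A word erasing to [d] is fixed by the positions of the letters of [d]. In the induction its
    first step is either flat or the first letter of [d], which is Pascal's rule. *)
Lemma card_flatless_fibre m (d : seq step) : H \notin d ->
  #|[set w : m.-tuple step | flatless w == d]| = 'C(m, size d).
Proof.
rewrite -sum1dep_card big_mkcond /=.
elim: m d => [|m IH] d Hd.
  rewrite (big_pred1 [tuple]) /=; last by move=> t; rewrite [t]tuple0; apply/esym/eqP.
  by case: d Hd.
rewrite big_tuple_cons big_step /=.
have IHd := IH _ Hd.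
case: d Hd IHd => [|x d] Hd IHd /=.
  by rewrite IHd !big1 ?bin0 //.
rewrite binS; case: x Hd IHd => //; rewrite inE /= => Hd IHd.
- rewrite -(IH d Hd) -IHd [X in (_ + (X + _))%R]big1 //.
  by rewrite add0r addnC; congr (_ + _)%N; apply: eq_bigr => w _;
    rewrite eqseq_cons eqxx.
- rewrite -(IH d Hd) -IHd [X in (X + _)%R]big1 //.
  by rewrite add0r addnC; congr (_ + _)%N; apply: eq_bigr => w _;
    rewrite eqseq_cons eqxx.
Qed.

Lemma nup_Dyck i (d : (2 * i).-tuple step) : d \in Dyck i -> nup d = i.
Proof.
rewrite inE => /andP[/Motzkin_count]; move: (nup d) => u E /count_memPn Hd.
by move: E; rewrite Hd; lia.
Qed.

Lemma sum_Motzkin_Dyck (V : pzRingType) (F : nat -> V) m i :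
  \sum_(M in Motzkin m | nup M == i) F (height M) =
  'C(m, 2 * i)%:R * \sum_(P in Dyck i) F (height P).
Proof.
(* The default tuple is junk: a Motzkin path with [i] up steps erases to a word of length exactly
   [2 * i], so it is never taken there ([pP]). *)
pose p (M : m.-tuple step) : (2 * i).-tuple step :=
  insubd (nseq_tuple (2 * i) U) (flatless M).
have pP M : M \in Motzkin m -> nup M == i -> flatless M = p M.
  move=> /Motzkin_count + /eqP Mi; rewrite Mi => Ms.
  rewrite /p insubdK // unfold_in /= size_filter.
  have -> : count (fun x => x != H) M = (size M - count_mem H M)%N.
    by rewrite -(count_predC (pred1 H) M) addKn.
  by rewrite size_tuple -[X in (X - _)%N]Ms addnK.
have nH s : H \notin flatless s by rewrite mem_filter eqxx.
rewrite (partition_big p (fun P => P \in Dyck i)) /=; last first.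
  move=> M /andP[M1 M2]; have E := pP M M1 M2.
  have := nH M; rewrite E => HM.
  by rewrite inE -(Motzkin_flatless E) M1.
rewrite mulr_sumr; apply: eq_bigr => P HP.
have [PM PH] : P \in Motzkin (2 * i) /\ H \notin P by move: HP; rewrite inE => /andP.
(* Erasing to [P] already forces [M] to be Motzkin with [i] up steps, so the fibre of [p] is the one
   counted by [card_flatless_fibre]. *)
have eP M : [&& M \in Motzkin m, nup M == i & p M == P] = (flatless M == P).
  apply/and3P/eqP => [[M1 M2 /eqP M3]|E]; first by rewrite pP // M3.
  have M1 : M \in Motzkin m by rewrite (Motzkin_flatless E).
  have M2 : nup M == i by rewrite (nup_flatless E) nup_Dyck.
  by split=> //; rewrite -val_eqE /= -pP //; apply/eqP.
rewrite (eq_bigl (fun M => M \in [set w : m.-tuple step | flatless w == P])); last first.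
  by move=> M; rewrite -andbA eP inE.
rewrite (eq_bigr (fun=> F (height P))); last first.
  by move=> M; rewrite inE => /eqP E; rewrite (height_flatless E).
by rewrite sumr_const card_flatless_fibre // size_tuple mulr_natl.
Qed.

(** * Nondecreasing maps and their left and right ends *)

Local Open Scope nat_scope.

(** The bound is strict: positions up to and including [v] are counted by [cnt P v.+1]. *)
Definition cnt (P : pred nat) k := count P (iota 0 k).

Lemma cntS P k : cnt P k.+1 = cnt P k + P k.
Proof. by rewrite /cnt -addn1 iotaD count_cat /= addn0. Qed.

Lemma eq_cnt (P Q : pred nat) k : (forall j, j < k -> P j = Q j) -> cnt P k = cnt Q k.
Proof. by move=> eqPQ; apply: eq_in_count => j; rewrite mem_iota => /eqPQ. Qed.

Lemma leq_cnt P : {homo cnt P : j k / j <= k}.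
Proof. by apply: homo_leq => [//|? ? ?|k]; [apply: leq_trans | rewrite cntS leq_addr]. Qed.

Lemma ltn_cnt (P : pred nat) j k : P j -> j < k -> cnt P j < cnt P k.
Proof.
by move=> Pj ltjk; apply: leq_trans (leq_cnt P ltjk); rewrite cntS Pj addn1.
Qed.

Section MonotoneMap.

Variables (m : nat) (l : nat -> nat).
Hypothesis l_le : forall k, k <= m -> l k <= k.
Hypothesis lS : forall k, k < m -> l k <= l k.+1.

Definition left_end u := u \in [seq l k | k <- iota 0 m.+1].
(** The guard makes [m] a right end whatever [l] is, as the last vertex always closes a
    peak-clique. *)
Definition right_end k := (k < m) ==> (l k != l k.+1).

Lemma left_endP u : reflect (exists2 k, k <= m & u = l k) (left_end u).
Proof.
by apply: (iffP mapP) => -[k]; rewrite ?mem_iota => Hk ->; exists k; rewrite ?mem_iota.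
Qed.

Lemma left_end_map k : k <= m -> left_end (l k).
Proof. by move=> lekm; apply/left_endP; exists k. Qed.

Lemma l_mono j k : j <= k -> k <= m -> l j <= l k.
Proof.
elim: k => [|k IH]; first by rewrite leqn0 => /eqP->.
rewrite leq_eqVlt => /orP[/eqP-> //|le_jk] lt_km.
exact: leq_trans (IH le_jk (ltnW lt_km)) (lS lt_km).
Qed.

Lemma right_end_ltn j k : right_end j -> j < k -> k <= m -> l j < l k.
Proof.
move=> Rj lt_jk le_km; have lt_jm := leq_trans lt_jk le_km.
apply: leq_trans (l_mono lt_jk le_km).
by rewrite ltn_neqAle lS // andbT; move: Rj; rewrite /right_end lt_jm.
Qed.

(** The right end attached to a value of [l] is the largest index at which [l] takes that value. *)
Lemma left_end_right_end u : left_end u -> exists j, [/\ j <= m, right_end j & l j = u].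
Proof.
case/left_endP=> k le_km ->.
have Pk : (k <= m) && (l k == l k) by rewrite le_km eqxx.
have bP j : (j <= m) && (l j == l k) -> j <= m by case/andP.
have [j /andP[le_jm /eqP Ej] jmax] := ex_maxnP (ex_intro _ k Pk) bP.
exists j; split=> //; apply/implyP => lt_jm; apply/eqP => E.
by have := jmax j.+1; rewrite lt_jm -E Ej eqxx ltnn => /(_ isT).
Qed.

(** [l] maps the right ends bijectively onto its image: it increases strictly after each right end,
    and each fibre has a largest element. Counting left ends thus becomes counting right ends. *)
Lemma perm_left_ends :
  perm_eq [seq l j | j <- iota 0 m.+1 & right_end j] (filter left_end (iota 0 m.+1)).
Proof.
apply: uniq_perm; last 1 first.
- move=> u; rewrite mem_filter mem_iota add0n leq0n andTb; apply/mapP/andP => [[j]|[]].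
    rewrite mem_filter mem_iota add0n ltnS => /andP[_ le_jm] ->.
    by rewrite left_end_map // ltnS (leq_trans (l_le le_jm)).
  move=> /left_end_right_end[j [le_jm Rj <-]] _.
  by exists j; rewrite // mem_filter Rj mem_iota.
- rewrite map_inj_in_uniq ?filter_uniq ?iota_uniq // => j k.
  rewrite !mem_filter !mem_iota /= => /andP[Rj lt_jm] /andP[Rk lt_km] E.
  by case: (ltngtP j k) => // /right_end_ltn; rewrite E => H;
     [move: (H Rj lt_km) | move: (H Rk lt_jm)]; rewrite ltnn.
by rewrite filter_uniq ?iota_uniq.
Qed.

Lemma cnt_left_end v : v <= m ->
  cnt left_end v.+1 = count (fun j => right_end j && (l j <= v)) (iota 0 m.+1).
Proof.
move=> le_vm.
transitivity (count (fun u => u <= v) (filter left_end (iota 0 m.+1))).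
  rewrite count_filter /cnt -[in RHS](subnKC le_vm) -addSn iotaD count_cat.
  rewrite [X in (_ + X)%N](@eq_in_count _ _ pred0) ?count_pred0 ?addn0 => [|u].
    by apply: eq_in_count => u; rewrite mem_iota /= add0n ltnS => ->.
  by rewrite mem_iota add0n => /andP[lt_vu _] /=; rewrite leqNgt lt_vu.
rewrite -(permP perm_left_ends) count_map count_filter.
by apply: eq_count => j /=; rewrite andbC.
Qed.

(** This is the inversion formula. From [k] to [k.+1], either [k] is not a right end and [l] stays
    put, or [l] jumps to the next element of its image, and by monotonicity skips none. *)
Lemma cnt_left_end_rank k : k <= m -> cnt left_end (l k) = cnt right_end k.
Proof.
elim: k => [|k IH] le_km; first by have := l_le le_km; rewrite leqn0 => /eqP->.
rewrite cntS -IH 1?ltnW // /right_end le_km implyTb.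
case: eqP => [<-|/eqP ne]; first by rewrite addn0.
have lt_l : l k < l k.+1 by rewrite ltn_neqAle ne lS.
rewrite /cnt -(subnKC lt_l) iotaD count_cat -/(cnt _ _) cntS left_end_map 1?ltnW //=.
rewrite [X in (_ + X)%N](@eq_in_count _ _ pred0) ?count_pred0 ?addn0 // => u.
rewrite mem_iota subnKC // add0n => /andP[lt1 lt2]; apply/negP => /left_endP[j le_jm Eu].
case: (leqP j k) => [le_jk|lt_kj].
  by move: lt1; rewrite Eu ltnNge l_mono // ltnW.
by move: lt2; rewrite Eu ltnNge l_mono.
Qed.

(** [l v] is a left end, at most [v], whose rank is the number of right ends before [v]; it is the
    extra element that makes the inequality strict. This becomes nonnegativity of the path. *)
Lemma right_end_ltn_left_end v : v <= m -> cnt right_end v < cnt left_end v.+1.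
Proof.
move=> le_vm; rewrite -cnt_left_end_rank //; apply: ltn_cnt; last by rewrite ltnS l_le.
exact: left_end_map.
Qed.

Lemma cnt_ends : cnt left_end m.+1 = cnt right_end m.+1.
Proof.
rewrite cnt_left_end //; apply: eq_in_count => j; rewrite mem_iota add0n /= ltnS => le_jm.
by rewrite (leq_trans (l_le le_jm)) ?andbT.
Qed.

(** Left ends up to [v] correspond to right ends [j] with [l j <= v]. Those with [j < v] must be
    removed, and since [l j <= j] they are all the right ends below [v]. *)
Lemma cnt_nesting v : v <= m ->
  count (fun j => [&& right_end j, l j <= v & v <= j]) (iota 0 m.+1) =
  cnt left_end v.+1 - cnt right_end v.
Proof.
move=> le_vm; rewrite cnt_left_end //.
rewrite -[in LHS](subnKC (leqW le_vm)) -[in RHS](subnKC (leqW le_vm)) !iotaD !count_cat.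
have -> : cnt right_end v = count (fun j => right_end j && (l j <= v)) (iota 0 v).
  apply: eq_in_count => j; rewrite mem_iota add0n /= => lt_jv.
  by rewrite (leq_trans (l_le _)) ?andbT ?(ltnW lt_jv) // (leq_trans (ltnW lt_jv)).
rewrite addKn [X in (X + _)%N](@eq_in_count _ _ pred0) ?count_pred0 ?add0n => [|j].
  apply: eq_in_count => j; rewrite mem_iota => /andP[le_vj _].
  by rewrite le_vj andbT.
by rewrite mem_iota add0n /= [v <= j]leqNgt => ->; rewrite !andbF.
Qed.

End MonotoneMap.

(** [l k] and [l' k] belong to the same set of left ends and have the same rank in it. *)
Lemma ends_inj m (l l' : nat -> nat) :
    (forall k, k <= m -> l k <= k) -> (forall k, k < m -> l k <= l k.+1) ->
    (forall k, k <= m -> l' k <= k) -> (forall k, k < m -> l' k <= l' k.+1) ->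
    (forall k, k <= m -> left_end m l k = left_end m l' k) ->
    (forall k, k <= m -> right_end m l k = right_end m l' k) ->
  forall k, k <= m -> l k = l' k.
Proof.
move=> l_le lS l'_le l'S eqL eqR k le_km.
have le_lm : l k <= m := leq_trans (l_le k le_km) le_km.
have le_l'm : l' k <= m := leq_trans (l'_le k le_km) le_km.
have E : cnt (left_end m l) (l k) = cnt (left_end m l) (l' k).
  rewrite cnt_left_end_rank // (@eq_cnt _ (right_end m l')) => [|j lt_jk]; last first.
    by rewrite eqR // (leq_trans (ltnW lt_jk)).
  rewrite -cnt_left_end_rank //; apply: eq_cnt => u lt_u.
  by rewrite eqL // (leq_trans (ltnW lt_u)).
case: (ltngtP (l k) (l' k)) => // lt_l.
  by have := ltn_cnt (left_end_map l le_km) lt_l; rewrite E ltnn.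
have Ll' : left_end m l (l' k) by rewrite eqL // left_end_map.
by have := ltn_cnt Ll' lt_l; rewrite E ltnn.
Qed.

(** * Constructing a monotone map with prescribed ends *)

Section Realize.

Variables (m : nat) (L R : pred nat).
Hypothesis ltRL : forall k, k <= m -> cnt R k < cnt L k.+1.
Hypothesis cntRL : cnt L m.+1 = cnt R m.+1.

Let Ls := filter L (iota 0 m.+1).
(** The inversion formula read backwards: the element of [L] of rank [cnt R j]. The default 0 is not
    reached for [j <= m], by [rank_lt]. *)
Definition realize j := nth 0 Ls (cnt R j).

Let size_Ls : size Ls = cnt R m.+1.
Proof. by rewrite size_filter -cntRL. Qed.

Let Ls_sorted : sorted ltn Ls.
Proof. by apply: sorted_filter; [exact: ltn_trans | exact: iota_ltn_sorted]. Qed.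

Let Ls_uniq : uniq Ls.
Proof. by rewrite filter_uniq ?iota_uniq. Qed.

Let rank_lt k : k <= m -> cnt R k < size Ls.
Proof.
by move=> le_km; rewrite size_filter -/(cnt L _) (leq_trans (ltRL le_km)) ?leq_cnt.
Qed.

Lemma realize_le k : k <= m -> realize k <= k.
Proof.
(* By [ltRL], more than [cnt R k] elements of [L] lie in positions 0 to [k], so the selected one is
   among them. *)
move=> le_km; rewrite /realize /Ls -(subnKC le_km) -addSn iotaD filter_cat nth_cat.
rewrite size_filter -/(cnt _ _) ltRL //.
have /(mem_nth 0) : cnt R k < size (filter L (iota 0 k.+1)) by rewrite size_filter ltRL.
by rewrite mem_filter mem_iota add0n ltnS => /andP[_].
Qed.

Lemma realize_eq j k : j <= m -> k <= m -> (realize j == realize k) = (cnt R j == cnt R k).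
Proof. by move=> le_jm le_km; rewrite nth_uniq ?rank_lt. Qed.

Lemma realizeS k : k < m -> realize k <= realize k.+1.
Proof.
move=> lt_km; have lt1 := rank_lt lt_km; have lt0 := rank_lt (ltnW lt_km).
have := leq_cnt R (leqnSn k); rewrite leq_eqVlt => /orP[/eqP E|lt_c].
  by rewrite /realize E.
exact/ltnW/(sorted_ltn_nth ltn_trans).
Qed.

Lemma right_end_realize k : k < m -> right_end m realize k = R k.
Proof.
move=> lt_km; rewrite /right_end lt_km (realize_eq (ltnW lt_km) lt_km) cntS.
by case: (R k); rewrite ?addn0 ?eqxx // addn1 neq_ltn ltnSn.
Qed.

Lemma left_end_realize u : u <= m -> left_end m realize u = L u.
Proof.
move=> le_um; apply/left_endP/idP => [[k le_km ->]|Lu].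
  by have := mem_nth 0 (rank_lt le_km); rewrite mem_filter => /andP[].
have uLs : u \in Ls by rewrite mem_filter Lu mem_iota.
have := uLs; rewrite -index_mem size_Ls => lt_i.
(* A discrete intermediate value argument: [cnt R] starts at 0, grows by at most one at each step
   and, by [cntRL], finally exceeds the rank of [u]; just before first exceeding it, it equals that
   rank. *)
have exk : exists k, index u Ls < cnt R k by exists m.+1.
have [[|k]] := ex_minnP exk; first by rewrite /cnt.
move=> lt_k kmin.
have le_km : k <= m by rewrite -ltnS kmin.
have le_k : cnt R k <= index u Ls.
  by rewrite leqNgt; apply/negP => /kmin; rewrite ltnn.
exists k => //; rewrite /realize.
suff -> : cnt R k = index u Ls by rewrite nth_index.
apply/eqP; rewrite eqn_leq le_k -ltnS; apply: leq_trans lt_k _.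
by rewrite cntS -addn1 leq_add2l leq_b1.
Qed.

End Realize.

(** * Area sequences and bicoloured Motzkin paths *)

Section AreaSequence.

Variables (m : nat) (a : {ffun 'I_m.+1 -> 'I_m.+1}).

(** Extended to all naturals through [inord] so that the results on monotone maps apply; only the
    values at [k <= m] carry meaning. *)
Definition leftmost k := k - a (inord k).

Lemma leftmostE (x : 'I_m.+1) : leftmost x = x - a x.
Proof. by rewrite /leftmost inord_val. Qed.

Lemma leftmost_le k : leftmost k <= k.
Proof. exact: leq_subr. Qed.

Hypothesis aDP : a \in DP m.+1.

Lemma area_le (x : 'I_m.+1) : a x <= x.
Proof. by move: aDP; rewrite inE => /andP[/forallP]. Qed.

Lemma leftmostS k : k < m -> leftmost k <= leftmost k.+1.
Proof.
move=> lt_km; move: aDP.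
rewrite inE => /andP[_ /forallP/(_ (inord k))/forallP/(_ (inord k.+1))].
rewrite !inordK ?(leqW lt_km) // eqxx /leftmost; lia.
Qed.

Let l_le k (_ : k <= m) := leftmost_le k.
Notation Rt := (right_end m leftmost).

Lemma edgeE (x y : 'I_m.+1) : x < y -> uig_edge a x y = (leftmost y <= x).
Proof. by move=> lt_xy; rewrite /uig_edge lt_xy ltnNge (ltnW lt_xy) orbF leftmostE. Qed.

Lemma edgeC (x y : 'I_m.+1) : uig_edge a x y = uig_edge a y x.
Proof. by rewrite /uig_edge orbC. Qed.

Lemma isolatedE (x : 'I_m.+1) : isolated a x = Rt x && (leftmost x == x).
Proof.
apply/forallP/andP => [isol|[Rx /eqP lx] y].
  split.
    apply/implyP => lt_xm; rewrite neq_ltn.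
    have xSE : (inord x.+1 : 'I_m.+1) = x.+1 :> nat by apply: inordK.
    have := isol (inord x.+1); rewrite edgeE ?xSE //.
    by rewrite -ltnNge => /(leq_ltn_trans (leftmost_le x)) ->.
  rewrite eqn_leq leftmost_le /=; case: (posnP x) => [-> //|x_gt0].
  have xPE : (inord x.-1 : 'I_m.+1) = x.-1 :> nat.
    by apply: inordK; apply: leq_ltn_trans (leq_pred _) _.
  have := isol (inord x.-1); rewrite edgeC edgeE xPE -?ltnNge; last by rewrite prednK.
  by rewrite prednK.
case: (ltngtP x y) => [lt_xy|lt_yx|/val_inj->]; last by rewrite /uig_edge ltnn.
  by rewrite edgeE // -ltnNge -{1}lx (right_end_ltn leftmostS) // -ltnS.
by rewrite edgeC edgeE // -ltnNge lx.
Qed.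

(** For an edge from x to y, failure to extend right means that the leftmost neighbour of y + 1 lies
    beyond x, so y is a right end; failure to extend left means that x is the leftmost neighbour of
    y. An isolated vertex is the degenerate case x = y. *)
Lemma peak_edgeE (p : 'I_m.+1 * 'I_m.+1) :
  peak_edge a p = Rt p.2 && (leftmost p.2 == p.1).
Proof.
case: p => x y; rewrite /peak_edge /= -val_eqE /=.
case: (ltngtP x y) => [lt_xy|lt_yx|/val_inj->]; last by rewrite isolatedE orbF.
  rewrite edgeE //=; apply/and3P/andP => [[le_lx /forallP Hy /forallP Hx]|[Ry /eqP ly]].
    split.
      apply/implyP => lt_ym; rewrite neq_ltn.
      have ySE : (inord y.+1 : 'I_m.+1) = y.+1 :> nat by apply: inordK.
      have := Hy (inord y.+1); rewrite ySE eqxx edgeE ySE; last exact: ltnW.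
      rewrite implyTb -ltnNge.
      by move=> /(leq_ltn_trans le_lx) ->.
    rewrite eqn_leq le_lx /=; case: (posnP x) => [-> //|x_gt0].
    have xPE : (inord x.-1 : 'I_m.+1) = x.-1 :> nat.
      by apply: inordK; apply: leq_ltn_trans (leq_pred _) _.
    have := Hx (inord x.-1); rewrite xPE prednK // eqxx edgeE xPE.
      by rewrite implyTb -ltnNge prednK.
    by rewrite prednK // ltnW.
  split; first by rewrite ly.
    apply/forallP => z; apply/implyP => /eqP zE.
    rewrite edgeE zE; last exact: ltnW.
    by rewrite -ltnNge -ly -zE (right_end_ltn leftmostS) ?zE // -zE -ltnS.
  apply/forallP => z; apply/implyP => /eqP zE.
  have lt_zy : z < y by rewrite (ltn_trans _ lt_xy) // -zE.
  by rewrite edgeE // -ltnNge ly -zE.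
rewrite /=; apply/esym/negP => /andP[_ /eqP E].
by have := leftmost_le y; rewrite E leqNgt lt_yx.
Qed.

Definition right_clique (j : 'I_m.+1) : {set 'I_m.+1} :=
  [set v : 'I_m.+1 | leftmost j <= v <= j].

(** A clique has its right end as greatest element. This is needed because [peak_nesting] counts
    cliques as sets, while the counts above run over right ends. *)
Lemma right_clique_inj : injective right_clique.
Proof.
have mem_j j : j \in right_clique j by rewrite inE leqnn leftmost_le.
move=> j k E; apply: val_inj; apply/eqP; rewrite eqn_leq.
have := mem_j j; rewrite E inE => /andP[_ ->].
by have := mem_j k; rewrite -E inE => /andP[_ ->].
Qed.

Lemma peak_cliquesE : peak_cliques a =
  [set right_clique j | j : 'I_m.+1 in [pred j | Rt (val j)]].
Proof.
apply/setP => C; apply/imsetP/imsetP => [[[x y]]|[j]]; rewrite inE.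
  rewrite peak_edgeE /= => /andP[Ry /eqP ly] ->; exists y => //.
  by apply/setP => v; rewrite !inE /= ly.
move=> Rj ->; have lt_l : leftmost j < m.+1 by rewrite (leq_ltn_trans (leftmost_le j)).
exists (Ordinal lt_l, j); first by rewrite inE peak_edgeE Rj eqxx.
by apply/setP => v; rewrite !inE.
Qed.

Lemma peak_nestingE (v : 'I_m.+1) :
  peak_nesting a v = cnt (left_end m leftmost) v.+1 - cnt Rt v.
Proof.
have le_vm : v <= m by rewrite -ltnS.
rewrite -cnt_nesting //; last exact: leftmostS.
rewrite /peak_nesting peak_cliquesE.
have -> : [set C in [set right_clique j | j : 'I_m.+1 in [pred j | Rt (val j)]] | v \in C] =
  [set right_clique j | j in [set j : 'I_m.+1 | [&& Rt j, leftmost j <= v & v <= j]]].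
  apply/setP => C; rewrite !inE; apply/andP/imsetP => [[/imsetP[j]]|[j]].
    by rewrite inE => Rj -> ; rewrite inE => vj; exists j; rewrite ?inE ?Rj.
  rewrite inE => /andP[Rj vj] ->; split; last by rewrite inE.
  by apply/imsetP; exists j.
rewrite card_imset; last exact: right_clique_inj.
rewrite cardsE cardE {1}/enum_mem size_filter -val_enum_ord count_map enumT.
exact: eq_count.
Qed.

End AreaSequence.

(** * Two-coloured Motzkin paths as words in pairs of booleans *)

Definition shape (c : bool * bool) : step :=
  match c with (true, false) => D | (false, true) => U | _ => H end.

Section ColouredPath.

Variables (m : nat) (c : m.-tuple (bool * bool)).

(** Letter [k'] tells whether [k'] is a right end and whether [k'.+1] is a left end, hence the
    shift. Position 0 is always a left end, since l 0 = 0. *)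
Definition code_left k := if k is k'.+1 then (nth (true, true) c k').2 else true.
(* The default value makes [m] a right end. *)
Definition code_right k := (nth (true, true) c k).1.

Definition shapes : m.-tuple step := [tuple of map shape c].

(** Each step adds its left-end bit and subtracts its right-end bit; the final 1 removes the left
    end at 0, which no letter records. *)
Lemma ycoord_shapes k : k <= m ->
  (ycoord shapes k = (cnt code_left k.+1)%:Z - (cnt code_right k)%:Z - 1)%R.
Proof.
elim: k => [|k IH] lt_km; first by rewrite /ycoord /= take0 big_nil.
rewrite /ycoord (take_nth H) ?size_tuple // -cats1 big_cat big_seq1 -/(ycoord _ _).
rewrite IH 1?ltnW //= (nth_map (true, true)) ?size_tuple //.
rewrite (cntS _ k.+1) (cntS (code_right) k) [code_left k.+1]/= [code_right k]/code_right.
by case: (nth _ _ _) => [[] []] /=; lia.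
Qed.

Lemma Motzkin_shapes : reflect
  ((forall k, k <= m -> cnt code_right k < cnt code_left k.+1) /\
   cnt code_left m.+1 = cnt code_right m.+1) (shapes \in Motzkin m).
Proof.
(* The right end at [m] comes from the default value; it balances the left end at 0, so that ending
   at ordinate 0 means equal totals. *)
have cntRm : cnt code_right m.+1 = cnt code_right m + 1.
  by rewrite cntS {2}/code_right nth_default ?size_tuple.
rewrite inE; apply: (iffP andP) => [[/forallP Hw /eqP Hm]|[Hw Hm]]; split.
- move=> k le_km; have := Hw (@Ordinal m.+1 k le_km).
  by rewrite /= ycoord_shapes //; lia.
- by rewrite cntRm; move: Hm; rewrite ycoord_shapes //; lia.
- apply/forallP => k; have le_km : k <= m by rewrite -ltnS.
  by rewrite ycoord_shapes //; have := Hw _ le_km; lia.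
by rewrite ycoord_shapes // Hm cntRm; apply/eqP; lia.
Qed.

End ColouredPath.

(** The witness [i0] matters: over an empty type the two sides would be 0 and 1. *)
Lemma bigmaxS (I : finType) (i0 : I) (F : I -> nat) : \max_i (F i).+1 = (\max_i F i).+1.
Proof.
have cardI : 0 < #|I| by apply/card_gt0P; exists i0.
apply/eqP; rewrite eqn_leq; apply/andP; split.
  by apply/bigmax_leqP => i _; rewrite ltnS leq_bigmax.
have [i ->] := eq_bigmax F cardI.
exact: (leq_bigmax i).
Qed.

Definition code m (a : {ffun 'I_m.+1 -> 'I_m.+1}) : m.-tuple (bool * bool) :=
  [tuple (right_end m (leftmost a) i, left_end m (leftmost a) i.+1) | i < m].

Section Code.

Variable m : nat.
Implicit Types a : {ffun 'I_m.+1 -> 'I_m.+1}.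

Lemma nth_code a k : k < m ->
  nth (true, true) (code a) k = (right_end m (leftmost a) k, left_end m (leftmost a) k.+1).
Proof. by move=> lt_km; rewrite -(tnth_nth _ _ (Ordinal lt_km)) tnth_mktuple. Qed.

Lemma code_left_code a k : k <= m -> code_left (code a) k = left_end m (leftmost a) k.
Proof.
case: k => [_|k lt_km]; last by rewrite /= nth_code.
by apply/esym/left_endP; exists 0.
Qed.

Lemma code_right_code a k : k <= m -> code_right (code a) k = right_end m (leftmost a) k.
Proof.
rewrite leq_eqVlt /code_right => /orP[/eqP->|lt_km]; last by rewrite nth_code.
by rewrite nth_default ?size_tuple // /right_end ltnn.
Qed.

Lemma cnt_code_left a k : k <= m ->
  cnt (code_left (code a)) k.+1 = cnt (left_end m (leftmost a)) k.+1.
Proof.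
by move=> le_km; apply: eq_cnt => j lt_j; rewrite code_left_code // (leq_trans _ le_km).
Qed.

Lemma cnt_code_right a k : k <= m.+1 ->
  cnt (code_right (code a)) k = cnt (right_end m (leftmost a)) k.
Proof.
move=> le_km; apply: eq_cnt => j lt_j; rewrite code_right_code //.
by rewrite -ltnS (leq_trans lt_j).
Qed.

Lemma code_Motzkin a : a \in DP m.+1 -> shapes (code a) \in Motzkin m.
Proof.
move=> aDP; have l_le k (_ : k <= m) := leftmost_le a k.
apply/Motzkin_shapes; split=> [k le_km|].
  rewrite cnt_code_left // (cnt_code_right _ (leqW le_km)).
  exact (right_end_ltn_left_end l_le (leftmostS aDP) le_km).
rewrite cnt_code_left // cnt_code_right //.
exact (cnt_ends l_le (leftmostS aDP)).
Qed.

(** The equality holds term by term: vertex [v] of the graph is matched with the point of abscissa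
    [v] of the path, whose ordinate is one less than the peak-nesting. *)
Lemma pnest_code a : a \in DP m.+1 -> pnest a = (height (shapes (code a))).+1.
Proof.
move=> aDP; rewrite /height -(bigmaxS ord0); apply: eq_bigr => v _.
have le_vm : v <= m by rewrite -ltnS.
have /Motzkin_shapes[/(_ v le_vm)] := code_Motzkin aDP.
rewrite peak_nestingE // ycoord_shapes // cnt_code_left // (cnt_code_right _ (leqW le_vm)).
by lia.
Qed.

Lemma code_inj : {in DP m.+1 &, injective (@code m)}.
Proof.
move=> a b aDP bDP E; apply/ffunP => x; apply: val_inj => /=.
have le_xm : x <= m by rewrite -ltnS.
suff : leftmost a x = leftmost b x.
  rewrite !leftmostE; have := area_le aDP x; have := area_le bDP x; lia.
apply: (@ends_inj m) le_xm => [k _|k|k _|k|k le_km|k le_km].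
- exact: leftmost_le.
- exact: leftmostS.
- exact: leftmost_le.
- exact: leftmostS.
- by rewrite -!code_left_code ?E.
by rewrite -!code_right_code ?E.
Qed.

Lemma code_surj (c : m.-tuple (bool * bool)) : shapes c \in Motzkin m ->
  exists2 a, a \in DP m.+1 & c = code a.
Proof.
case/Motzkin_shapes=> ltRL cntRL.
pose l := realize m (code_left c) (code_right c).
have l_le k : k <= m -> l k <= k by apply: realize_le.
have lS k : k < m -> l k <= l k.+1 by apply: realizeS.
(* Solving [leftmost a x = l x] for the area. *)
pose a : {ffun 'I_m.+1 -> 'I_m.+1} := [ffun x : 'I_m.+1 => inord (x - l x)].
have aE k : k <= m -> a (inord k) = k - l k :> nat.
  by move=> le_km; rewrite ffunE !inordK // ltnS (leq_trans (leq_subr _ _)).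
have laE k : k <= m -> leftmost a k = l k.
  by move=> le_km; rewrite /leftmost aE // subKn ?l_le.
exists a.
  rewrite inE; apply/andP; split; apply/forallP => x.
    by rewrite -[x]inord_val aE ?inordK ?leq_subr // -ltnS.
  apply/forallP => y; apply/implyP => /eqP yE.
  have lt_xm : x < m by rewrite -ltnS -yE.
  have := lS x lt_xm; have := aE x (ltnW lt_xm); have := aE x.+1 lt_xm.
  by rewrite -[in inord _]yE !inord_val; lia.
apply: val_inj; apply: (@eq_from_nth _ (true, true)) => [|k].
  by rewrite !size_tuple.
rewrite size_tuple => lt_km.
rewrite nth_code // [LHS]surjective_pairing; congr pair.
  rewrite /right_end lt_km (laE _ lt_km) (laE _ (ltnW lt_km)).
  by have := right_end_realize ltRL lt_km; rewrite /right_end lt_km => ->.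
transitivity (left_end m l k.+1); first exact (esym (left_end_realize ltRL cntRL lt_km)).
by rewrite /left_end; congr (_ \in _); apply/eq_in_map => j; rewrite mem_iota => /laE.
Qed.

End Code.

(** * Forgetting colours and summing *)

Local Open Scope ring_scope.

(** Under [shape], [H] has two preimages while [U] and [D] have one each, so only flat steps leave a
    choice. *)
Lemma card_shapes_fibre m (w : m.-tuple step) :
  #|[set c : m.-tuple (bool * bool) | shapes c == w]| = (2 ^ count_mem H w)%N.
Proof.
have fibre m' (s : seq step) : size s = m' ->
    (\sum_(c : m'.-tuple (bool * bool)) (map shape c == s : nat) = 2 ^ count_mem H s)%N.
  elim: m' s => [|m' IH] [|x s] //= => [_|[ss]].
    by rewrite (big_pred1 [tuple]) // => t; rewrite [t]tuple0; apply/esym/eqP.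
  rewrite big_tuple_cons.
  have -> : (\sum_(y : bool * bool) \sum_(t : m'.-tuple (bool * bool))
        (map shape (cons_tuple y t) == x :: s : nat) =
      \sum_(y : bool * bool) (shape y == x) * 2 ^ count_mem H s)%N.
    apply: eq_bigr => y _; rewrite -(IH s ss) big_distrr; apply: eq_bigr => t _.
    by rewrite /= eqseq_cons mulnb.
  rewrite -big_distrl expnD; congr (_ * _)%N.
  rewrite (eq_bigr (fun y => (shape (y.1, y.2) == x : nat))); last by case.
  rewrite -(pair_bigA _ (fun y z => (shape (y, z) == x : nat))) /=.
  by rewrite !big_bool; case: x.
by rewrite -sum1dep_card big_mkcond /= -(fibre m) ?size_tuple.
Qed.

Lemma sum_shapes (V : pzRingType) (F : nat -> V) m :
  \sum_(c : m.-tuple (bool * bool) | shapes c \in Motzkin m) F (height (shapes c)) =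
  \sum_(M in Motzkin m) 2 ^+ (m - 2 * nup M) * F (height M).
Proof.
rewrite (partition_big (@shapes m) (fun M => M \in Motzkin m)) //=.
apply: eq_bigr => M HM.
rewrite (eq_bigl (fun c => c \in [set c : m.-tuple (bool * bool) | shapes c == M])); last first.
  by move=> c; rewrite inE andb_idl // => /eqP->.
rewrite (eq_bigr (fun=> F (height M))); last by move=> c; rewrite inE => /eqP->.
rewrite sumr_const card_shapes_fibre.
by rewrite (canRL (addKn _) (Motzkin_count HM)) -[LHS]mulr_natl natrX.
Qed.

Theorem corollary3p12 (n : nat) (n_ge1 : (1 <= n)%N) :
  Pnest n =
    \sum_(0 <= i < ((n - 1) %/ 2).+1)
      2 ^+ (n - 1 - 2 * i) *
      \sum_(M in Motzkin (n - 1) | nup M == i) 'X^((height M).+1)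
  /\
  \sum_(0 <= i < ((n - 1) %/ 2).+1)
      2 ^+ (n - 1 - 2 * i) *
      \sum_(M in Motzkin (n - 1) | nup M == i) 'X^((height M).+1) =
    \sum_(0 <= i < ((n - 1) %/ 2).+1)
      2 ^+ (n - 1 - 2 * i) * 'C(n - 1, 2 * i)%:R *
      \sum_(P in Dyck i) 'X^((height P).+1) :> {poly int}.
Proof.
case: n n_ge1 => // m _; rewrite subSS subn0; split; last first.
  by apply: eq_bigr => i _; rewrite (sum_Motzkin_Dyck (fun h => 'X^(h.+1))) mulrA.
have -> : Pnest m.+1 =
    \sum_(c : m.-tuple (bool * bool) | shapes c \in Motzkin m) 'X^((height (shapes c)).+1).
  rewrite /Pnest (eq_bigr (fun a => 'X^((height (shapes (code a))).+1))); last first.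
    by move=> a aDP; rewrite pnest_code.
  rewrite -(big_imset (fun c => 'X^((height (shapes c)).+1))) /=; last exact: code_inj.
  apply: eq_bigl => c; apply/imsetP/idP => [[a aDP ->]|]; first exact: code_Motzkin.
  exact: code_surj.
rewrite (sum_shapes (fun h => 'X^(h.+1))) big_mkord.
under [RHS]eq_bigr do rewrite mulr_sumr.
(* After the exchange each Motzkin path contributes for the single index [i = nup M], which lies in
   range because twice the number of up steps is at most [m]. *)
rewrite (exchange_big_dep (fun M => M \in Motzkin m)) /=; last by move=> i M _ /andP[].
apply: eq_bigr => M HM.
have lt_u : (nup M < (m %/ 2).+1)%N.
  by rewrite ltnS leq_divRL // mulnC -[leqRHS](Motzkin_count HM) leq_addr.
rewrite (big_pred1 (Ordinal lt_u)) // => i.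
by rewrite HM /= eq_sym.
Qed.
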